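(* Assume hypotheses (H1), (H2), (H3) of the context. The fully discrete scheme (F) of the context is reversible in time. Specifically, the solution map $$S(\Delta t):(\boldsymbol u_h^k,\varrho_h^k,\varsigma_h^k,\beta_h^k)\mapsto(\boldsymbol u_h^{k+1},\varrho_h^{k+1},\varsigma_h^{k+1},\beta_h^{k+1})$$ defined by (F) satisfies $$S(-\Delta t)=S(\Delta t)^{-1}.$$
   Context: Setting. $\Omega$ is a domain in $\mathbb{R}^n$ ($n=2,3$); $X(\Omega)$ is the set of vector fields in $\Omega$ that are tangent to the boundary $\partial\Omega$. $d$ is the exterior derivative, $\star$ the Hodge operator, and $i_{\boldsymbol u}$ the (continuous) interior product with a vector field $\boldsymbol u$. $e$ is the internal energy, a function of density and entropy. An $n$-form $\varrho=\rho\,dV$ is identified with its scalar density $\rho$ where needed (as an argument of $e$, in quotients, and in products inside integrands), e.g. $\int_\Omega(\varrho\boldsymbol u)\cdot\boldsymbol v=\int_\Omega\rho\,\boldsymbol u\cdot\boldsymbol v\,dV$. (H1) $(V_h^i)_{i=0,\dots,n}$ is a sequence of discrete spaces, $V_h^i$ consisting of $i$-forms on $\Omega$, such that $d(V_h^i)\subset V_h^{i+1}$. (H2) There exist projection operators $\Pi^i$ onto the discrete spaces $V_h^i$, $i\in\{0,\dots,n\}$, that preserve the vanishing of forms at the boundary $\partial\Omega$. $X_h\subset X(\Omega)$ is a discrete vector field space. Let $$\mathfrak g_h=\{(A^0,\dots,A^n)\in L(V_h^0)\times\cdots\times L(V_h^n):\ dA^{i-1}=A^i d\},$$ where $L(V)$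 is the space of linear operators from $V$ to itself, with bracket $[A,B]^i=A^iB^i-B^iA^i$. For $\boldsymbol u_h\in X_h$, the operator $A_{\boldsymbol u_h}=(A^0_{\boldsymbol u_h},\dots,A^n_{\boldsymbol u_h})\in\mathfrak g_h$ is defined by $$A^i_{\boldsymbol u_h}\alpha_h=d\,\Pi^{i-1}(i_{\boldsymbol u_h}\alpha_h)+\Pi^i(i_{\boldsymbol u_h}d\alpha_h),\qquad \alpha_h\in V_h^i,\ i\in\{0,\dots,n\}$$ (the first term is $0$ for $i=0$, the second is $0$ for $i=n$). (H3) The map $\boldsymbol u\mapsto A_{\boldsymbol u}$ from $X_h$ to $\mathfrak g_h$ is injective, and one can build a pseudo-inverse (left inverse), denoted as a hat map $\hat{\cdot}:\mathfrak g_h\to X_h$, such that $\widehat{A_{\boldsymbol u_h}}=\boldsymbol u_h$ for all $\boldsymbol u_h\in X_h$. Fully discrete scheme (F). The time step $\Delta t$ is constant; for any discrete variable $a^k=a(\cdot,k\Delta t)$ and $a^{k+\frac12}=\frac{a^{k+1}+a^k}{2}$. The unknowns are $\boldsymbol u_h^k\in X_h$, $\varrho_h^k,\varsigma_h^k\in V_h^n$ (density and entropy) and $\beta_h^k\in V_h^{n-1}$ (magnetic field). Writing $F^{a,b}=\varrho_h^{a}\,e(\varrho_h^{a},\varsigma_h^{b})$ for $a,b\in\{k,k+1\}$, the scheme reads: for all $\boldsymbol v_h\in X_h$, $$ \begin{aligned} &\int_\Omega\frac{\varrho_h^{k+1}\boldsymbol u_h^{k+1}-\varrho_h^k\boldsymbol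 u_h^k}{\Delta t}\cdot\boldsymbol v_h-\varrho_h^{k+\frac12}\boldsymbol u_h^{k+\frac12}\cdot\widehat{[A_{\boldsymbol v_h},A_{\boldsymbol u_h^{k+\frac12}}]}\\ &\quad+\Big(\frac{\boldsymbol u_h^k\cdot\boldsymbol u_h^{k+1}}{2}-\frac12\Big(\frac{F^{k+1,k+1}-F^{k,k+1}}{\varrho_h^{k+1}-\varrho_h^k}+\frac{F^{k+1,k}-F^{k,k}}{\varrho_h^{k+1}-\varrho_h^k}\Big)\Big)A^n_{\boldsymbol v_h}\varrho_h^{k+\frac12}\\ &\quad-\frac12\Big(\frac{F^{k+1,k+1}-F^{k+1,k}}{\varsigma_h^{k+1}-\varsigma_h^k}+\frac{F^{k,k+1}-F^{k,k}}{\varsigma_h^{k+1}-\varsigma_h^k}\Big)A^n_{\boldsymbol v_h}\varsigma_h^{k+\frac12}-\beta_h^{k+\frac12}\wedge\star A^{n-1}_{\boldsymbol v_h}\beta_h^{k+\frac12}=0, \end{aligned} $$ $$ \frac{\varrho_h^{k+1}-\varrho_h^k}{\Delta t}+A^n_{\boldsymbol u_h^{k+\frac12}}\varrho_h^{k+\frac12}=0,\qquad \frac{\varsigma_h^{k+1}-\varsigma_h^k}{\Delta t}+A^n_{\boldsymbol u_h^{k+\frac12}}\varsigma_h^{k+\frac12}=0,\qquad \frac{\beta_h^{k+1}-\beta_h^k}{\Delta t}+A^{n-1}_{\boldsymbol u_h^{k+\frac12}}\beta_h^{k+\frac12}=0 . $$ $S(-\Delta t)$ is the solution map defined by the same equations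 with $\Delta t$ replaced by $-\Delta t$. *)

(* Defs.v *)
From HB Require Import structures.
From mathcomp Require Import all_boot all_order all_algebra.
From mathcomp Require Import all_classical all_reals all_analysis.
From mathcomp Require Import ring lra.

Set Implicit Arguments.
Unset Strict Implicit.
Unset Printing Implicit Defensive.

Import Order.TTheory GRing.Theory Num.Theory.
Import numFieldNormedType.Exports.

Local Open Scope classical_set_scope.
Local Open Scope ring_scope.

Section Lebesgue.
Context (R : realType).
Local Notation mR := (measurableTypeR R).

Definition tcons n (p : n.-tuple mR * mR) : n.+1.-tuple mR :=
  [tuple of p.2 :: p.1].

Lemma measurable_tcons n : measurable_fun [set: n.-tuple mR * mR] (@tcons n).
Proof. exact: (@measurable_cons _ _ _ _ snd n fst). Qed.

(* n-fold product of the one-dimensional Lebesgue measure, on the Borel sets of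
   R^n; the long identifier is the library's pushforward measure, here along
   [tcons] *)
Fixpoint lebesguen (n : nat) : {measure set (n.-tuple mR) -> \bar R} :=
  match n return {measure set (n.-tuple mR) -> \bar R} with
  | 0 => \d_ [tuple]
  | m.+1 =>
      measure_function_pushforward__canonical__measure_function_Measure
        (lebesguen m \x lebesgue_measure)%E (@measurable_tcons m)
  end.

Definition pt n (t : n.-tuple mR) : 'rV[R]_n := \row_i tnth t i.

Definition integrable_on n (D : set 'rV[R]_n) (f : 'rV[R]_n -> R) : Prop :=
  (lebesguen n).-integrable (@pt n @^-1` D) (fun t => (f (pt t))%:E).

Definition integral_on n (D : set 'rV[R]_n) (f : 'rV[R]_n -> R) : R :=
  \int[lebesguen n]_(t in @pt n @^-1` D) f (pt t).

End Lebesgue.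

Section Domain.
Context (R : realType) (n : nat).
Implicit Types (Om : set 'rV[R]_n) (phi : 'rV[R]_n -> R).

Definition dotp (u v : 'rV[R]_n) : R := \sum_i u 0 i * v 0 i.

Definition is_domain Om := [/\ open Om, connected Om & Om !=set0].

Definition boundary Om := closure Om `\` interior Om.

(* velocities at x of curves drawn on the boundary; this is the tangent space
   at x wherever the boundary is a smooth hypersurface *)
Definition tangent_vector Om (x v : 'rV[R]_n) :=
  exists g : R -> 'rV[R]_n, [/\ g 0 = x, is_derive (0 : R) 1 g v &
    \forall t \near (0 : R), boundary Om (g t)].

Definition tangent_field Om (u : 'rV[R]_n -> 'rV[R]_n) :=
  forall x, boundary Om x -> tangent_vector Om x (u x).

Definition dbasis (j : 'I_n) : 'rV[R]_n := delta_mx 0 j.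

Definition smooth phi := forall (s : seq 'rV[R]_n) x,
  differentiable (foldr (fun v (f : 'rV[R]_n -> R) y => 'D_v f y) phi s) x.

Definition test_function Om phi := smooth phi /\
  exists2 K, compact K /\ K `<=` Om & forall x, ~ K x -> phi x = 0.

End Domain.

Section Forms.
Context (R : realType) (n : nat).

(* [w I] is the coefficient of dx^{i_1} /\ ... /\ dx^{i_k}, where
   I = {i_1 < ... < i_k}; all degrees live in the same type *)
Definition covec := {ffun {set 'I_n} -> R^o}.
Definition dform := 'rV[R]_n -> covec.
Implicit Types (w : covec) (al be : dform) (I J K : {set 'I_n}).

Definition has_degree k al := forall x I, #|I| != k -> al x I = 0.

(* dx^I /\ dx^J = shuffle_sign I J * dx^(I :|: J) for disjoint I and J *)
Definition shuffle_sign I J : R :=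
  (-1) ^+ #|[pred p : 'I_n * 'I_n | [&& p.1 \in I, p.2 \in J & (p.2 < p.1)%N]]|.

Definition wedge al be : dform := fun x => [ffun K : {set 'I_n} =>
  \sum_(I : {set 'I_n} | I \subset K)
    shuffle_sign I (K :\: I)%SET * al x I * be x (K :\: I)%SET].

(* characterised by al /\ hodge be = <al, be> dV, for al, be of equal degree *)
Definition hodge al : dform := fun x => [ffun J : {set 'I_n} =>
  shuffle_sign (~: J)%SET J * al x (~: J)%SET].

Definition icontract (v : 'rV[R]_n) w : covec := [ffun I : {set 'I_n} =>
  \sum_(j | j \notin I) shuffle_sign [set j]%SET I * v 0 j * w (j |: I)%SET].

Definition iprod (u : 'rV[R]_n -> 'rV[R]_n) al : dform :=
  fun x => icontract (u x) (al x).

(* w (v_1, ..., v_k) *)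
Definition eval_form w (vs : seq 'rV[R]_n) : R :=
  foldl (fun w' v => icontract v w') w vs finset.set0.

Definition density al (x : 'rV[R]_n) : R := al x [set: 'I_n]%SET.

(* the pullback of the k-form al to the boundary is zero *)
Definition vanishes_at_boundary (Om : set 'rV[R]_n) k al :=
  forall x, boundary Om x -> forall vs : k.-tuple 'rV[R]_n,
  (forall i, tangent_vector Om x (tnth vs i)) -> eval_form (al x) vs = 0.

Definition locally_integrable_form (Om : set 'rV[R]_n) al :=
  forall I (C : set 'rV[R]_n), compact C -> C `<=` Om ->
  integrable_on C (fun x => al x I).

(* Weak form of (d al)_K = \sum_(j in K) +- d/dx_j al_(K \ j) on Om: finite
   element forms are only piecewise smooth. *)
Definition is_ext_derivative (Om : set 'rV[R]_n) al be :=
  [/\ locally_integrable_form Om al, locally_integrable_form Om be &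
   forall K phi, test_function Om phi ->
     integral_on Om (fun x => be x K * phi x) =
     - \sum_(j in K) shuffle_sign [set j]%SET (K :\ j)%SET *
         integral_on Om (fun x => al x (K :\ j)%SET * 'D_(dbasis R j) phi x)].

(* For locally integrable coefficients: zero almost everywhere on Om. *)
Definition weakly_zero (Om : set 'rV[R]_n) al := forall K phi,
  test_function Om phi -> integral_on Om (fun x => al x K * phi x) = 0.

End Forms.

Section Schwarz.
Context (R : realType) (n : nat).
Implicit Types (Om : set 'rV[R]_n) (phi : 'rV[R]_n -> R).

Lemma smooth_derive phi v : smooth phi -> smooth (fun y => 'D_v phi y).
Proof.
move=> sphi s x.
by have := sphi (rcons s v) x; rewrite foldr_rcons.
Qed.

Lemma test_function_derive Om phi v :
  test_function Om phi -> test_function Om (fun y => 'D_v phi y).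
Proof.
case=> sphi [K [cK KOm] phi0]; split; first exact: smooth_derive.
exists K => // x nKx.
have -> : 'D_v phi x = 'D_v (cst 0) x.
  apply: near_eq_derive.
  have oC : open (~` K) by apply: closed_openC; apply: compact_closed cK; exact: norm_hausdorff.
  by have := open_nbhs_nbhs (conj oC nKx); apply: filterS => y; apply: phi0.
by rewrite derive_cst.
Qed.

Lemma is_derive_line phi (x v : 'rV[R]_n) (t : R) :
  (forall y, differentiable phi y) ->
  is_derive (t : R) (1 : R) (fun s : R => phi (x + s *: v)) ('D_v phi (x + t *: v)).
Proof.
move=> dphi.
have E : (fun h : R => h^-1 *: (((fun s : R => phi (x + s *: v)) \o
      shift t) (h *: (1 : R)) - phi (x + t *: v))) =
   (fun h : R => h^-1 *: ((phi \o shift (x + t *: v)) (h *: v) -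
      phi (x + t *: v))).
  apply/funext => h /=; congr (_ *: (phi _ - _)).
  by rewrite /GRing.scale/= mulr1 -/(GRing.scale _ _) scalerDl addrCA.
apply: DeriveDef.
  rewrite /derivable E; exact: (diff_derivable (dphi _)).
by rewrite /derive E.
Qed.

Lemma second_difference phi (x v w : 'rV[R]_n) (h : R) : smooth phi -> 0 < h ->
  exists2 p : R * R, 0 < p.1 < h /\ 0 < p.2 < h &
  phi (x + h *: v + h *: w) - phi (x + h *: v) - phi (x + h *: w) + phi x =
  h ^+ 2 * 'D_w (fun y => 'D_v phi y) (x + p.1 *: v + p.2 *: w).
Proof.
move=> sphi h0.
have d0 y : differentiable phi y by exact: (sphi [::]).
have d1 y : differentiable (fun y => 'D_v phi y) y by exact: (sphi [:: v]).
pose g (t : R) := phi (x + h *: w + t *: v) - phi (x + t *: v).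
have dg t : is_derive (t : R) (1 : R) g
    ('D_v phi (x + h *: w + t *: v) - 'D_v phi (x + t *: v)).
  by apply: is_deriveB; apply: is_derive_line.
have [|c cI gE] := @MVT _ g _ 0 h h0 (fun t _ => dg t).
  by apply: derivable_within_continuous => t _; apply: ex_derive.
pose k (t : R) := 'D_v phi (x + c *: v + t *: w).
have dk t : is_derive (t : R) (1 : R) k ('D_w (fun y => 'D_v phi y) (x + c *: v + t *: w)).
  exact: is_derive_line.
have [|e eI kE] := @MVT _ k _ 0 h h0 (fun t _ => dk t).
  by apply: derivable_within_continuous => t _; apply: ex_derive.
exists (c, e) => /=; first by move: cI eI; rewrite !in_itv/=.
move: gE kE; rewrite /g /k !scale0r !addr0 !subr0 => gE kE.
rewrite (addrAC x (h *: w) (c *: v)) kE in gE.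
rewrite expr2 mulrC mulrA -gE (addrAC x (h *: w)); ring.
Qed.

Lemma smooth_schwarz phi (x v w : 'rV[R]_n) : smooth phi ->
  'D_w (fun y => 'D_v phi y) x = 'D_v (fun y => 'D_w phi y) x.
Proof.
move=> sphi.
have cont2 a b : {for x, continuous (fun y => 'D_a (fun z => 'D_b phi z) y)}.
  exact: differentiable_continuous (sphi [:: a; b] x).
apply/eqP; rewrite -subr_eq0 -normr_le0; apply/ler_addgt0Pr => e e0.
rewrite add0r.
have e20 : 0 < e / 2 by rewrite divr_gt0.
have /cvgrPdist_lt/(_ _ e20)/nbhs_ballP[d1 /= d10 H1] := cont2 w v.
have /cvgrPdist_lt/(_ _ e20)/nbhs_ballP[d2 /= d20 H2] := cont2 v w.
pose M := 1 + `|v| + `|w|.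
have M0 : 0 < M by rewrite /M -addrA ltr_pwDl// addr_ge0.
pose h := Num.min d1 d2 / M.
have h0 : 0 < h by rewrite divr_gt0// lt_min d10.
have small (a b : R) : 0 < a < h -> 0 < b < h ->
    `|a *: v + b *: w| < Num.min d1 d2.
  move=> /andP[a0 ah] /andP[b0 bh].
  rewrite (le_lt_trans (ler_normD _ _))// !normrZ !gtr0_norm//.
  have -> : Num.min d1 d2 = h * M by rewrite /h divfK// gt_eqF.
  rewrite /M -addrA mulrDr mulr1 ltr_pwDl// mulrDr.
  by rewrite lerD// ler_wpM2r// ltW.
have [[a b] /= [ah bh] E1] := second_difference x v w sphi h0.
have [[a' b'] /= [ah' bh'] E2] := second_difference x w v sphi h0.
have : h ^+ 2 * 'D_w (fun y => 'D_v phi y) (x + a *: v + b *: w) =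
       h ^+ 2 * 'D_v (fun y => 'D_w phi y) (x + a' *: w + b' *: v).
  apply: (etrans (esym E1)); apply: etrans E2.
  by rewrite (addrAC x (h *: v)); congr (_ + _); apply: addrAC.
move/(mulfI (lt0r_neq0 (exprn_gt0 2 h0))) => E.
have /H1 N1 : ball x d1 (x + a *: v + b *: w).
  rewrite -ball_normE /ball_/= -addrA opprD addrA subrr sub0r normrN.
  by apply: (lt_le_trans (small _ _ ah bh)); rewrite ge_min lexx.
have /H2 N2 : ball x d2 (x + a' *: w + b' *: v).
  rewrite -ball_normE /ball_/= -addrA opprD addrA subrr sub0r normrN addrC.
  by apply: (lt_le_trans (small _ _ bh' ah')); rewrite ge_min lexx orbT.
cbv beta in N1, N2; rewrite E in N1.
set y := 'D_v _ (_ + b' *: v) in N1 N2.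
apply: ltW; rewrite [ltRHS]splitr.
apply: (le_lt_trans (ler_distD y _ _)).
rewrite (distrC y); exact: (ltrD N1 N2).
Qed.

End Schwarz.

Section ExtDerivative.
Context (R : realType) (n : nat).
Implicit Types (K I : {set 'I_n}) (Om : set 'rV[R]_n).

Lemma shuffle_sign1U (j l : 'I_n) I : l \notin I ->
  shuffle_sign R [set j]%SET (l |: I)%SET =
  (-1) ^+ (l < j)%N * shuffle_sign R [set j]%SET I.
Proof.
move=> lI; rewrite /shuffle_sign -exprD; congr (_ ^+ _).
rewrite (cardD1 (j, l)) !inE /= !eqxx /=; congr (_ + _)%N.
apply: eq_card => -[a b]; rewrite !inE /= xpair_eqE.
have [->|] := eqVneq a j; last by rewrite andbF.
by have [->|//] := eqVneq b l; rewrite /= (negbTE lI).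
Qed.

Lemma shuffle_sign_anti (j l : 'I_n) K : j \in K -> l \in K -> j != l ->
  shuffle_sign R [set j]%SET (K :\ j)%SET *
    shuffle_sign R [set l]%SET (K :\ j :\ l)%SET =
  - (shuffle_sign R [set l]%SET (K :\ l)%SET *
    shuffle_sign R [set j]%SET (K :\ l :\ j)%SET).
Proof.
move=> jK lK jl.
set I := (K :\ j :\ l)%SET.
have -> : (K :\ l :\ j)%SET = I.
  by apply/setP => i; rewrite !inE andbCA.
have -> : (K :\ j)%SET = (l |: I)%SET.
  by rewrite /I finset.setD1K// !inE eq_sym jl.
have -> : (K :\ l)%SET = (j |: I)%SET.
  apply/setP => i; rewrite !inE.
  have [->|] := eqVneq i j; first by rewrite jl jK.
  by [].
have jI : j \notin I by rewrite !inE eqxx andbF.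
have lI : l \notin I by rewrite !inE eqxx.
rewrite !shuffle_sign1U//.
have [||/val_inj/eqP] := ltngtP l j; last by rewrite eq_sym (negbTE jl).
- by rewrite expr1 expr0 mulN1r mul1r mulNr mulrC.
- by rewrite expr1 expr0 mulN1r mul1r mulNr opprK mulrC.
Qed.

Lemma ext_derivativeK Om (al be ga : dform R n) :
  is_ext_derivative Om al be -> is_ext_derivative Om be ga ->
  weakly_zero Om ga.
Proof.
move=> [_ _ dal] [_ _ dbe] K phi tphi.
rewrite dbe//; apply/eqP; rewrite oppr_eq0; apply/eqP.
pose X j l := integral_on Om (fun x => al x (K :\ j :\ l)%SET *
  'D_(dbasis R l) (fun y => 'D_(dbasis R j) phi y) x).
pose T j l := shuffle_sign R [set j]%SET (K :\ j)%SET *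
    shuffle_sign R [set l]%SET (K :\ j :\ l)%SET * X j l.
pose S := \sum_(j in K) \sum_(l in K | l != j) T j l.
have -> : \sum_(j in K) shuffle_sign R [set j]%SET (K :\ j)%SET *
    integral_on Om (fun x => be x (K :\ j)%SET * 'D_(dbasis R j) phi x) = - S.
  rewrite -sumrN; apply: eq_bigr => j jK.
  rewrite dal; last exact: test_function_derive.
  rewrite mulrN mulr_sumr; congr (- _).
  apply: eq_big => l; first by rewrite !inE andbC.
  by rewrite mulrA.
have XC j l : X j l = X l j.
  apply: (f_equal (integral_on Om)); apply/funext => x.
  have -> : (K :\ j :\ l)%SET = (K :\ l :\ j)%SET.
    by apply/setP => i; rewrite !inE andbCA.
  by apply: (f_equal (GRing.mul _)); apply: smooth_schwarz; case: tphi.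
have TN j l : j \in K -> l \in K -> j != l -> T j l = - T l j.
  by move=> jK lK jl; rewrite /T shuffle_sign_anti// XC mulNr.
have SN : S = - S.
  rewrite {1}/S (exchange_big_dep (mem K))/=; last by move=> j l _ /andP[].
  rewrite -sumrN; apply: eq_bigr => l lK; rewrite -sumrN.
  apply: eq_big => [j|j /andP[jK /andP[_ lj]]]; first by rewrite lK /= eq_sym.
  by rewrite TN// eq_sym.
suff -> : S = 0 by rewrite oppr0.
by move: SN; lra.
Qed.

End ExtDerivative.

(* The spaces are finite-dimensional and given with their embedding into
   forms; [dd] is the exterior derivative, uniquely determined by [ddP] and
   [realise_inj] (forms equal almost everywhere are identified).  The spaces
   for i > n are 0, as there are no i-forms. *)
Record discrete_forms (R : realType) (n : nat) (Om : set 'rV[R]_n) :=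
  DiscreteForms {
    dspace :> nat -> vectType R;
    realise : forall i, {linear dspace i -> dform R n};
    realise_degree : forall i (a : dspace i), has_degree i (realise i a);
    realise_inj : forall i (a : dspace i), weakly_zero Om (realise i a) -> a = 0;
    dd : forall i, 'Hom(dspace i, dspace i.+1);
    ddP : forall i (a : dspace i),
      is_ext_derivative Om (realise i a) (realise i.+1 (dd i a)) }.

Record discrete_fields (R : realType) (n : nat) (Om : set 'rV[R]_n) :=
  DiscreteFields {
    fspace :> vectType R;
    field_of : {linear fspace -> ('rV[R]_n -> 'rV[R]_n)};
    field_of_tangent : forall u, tangent_field Om (field_of u) }.

Arguments realise {R n Om} d {i}.
Arguments dd {R n Om} d i.
Arguments field_of {R n Om} d.

Section Advection.
Context (R : realType) (n : nat) (Om : set 'rV[R]_n).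
Context (V : discrete_forms Om) (X : discrete_fields Om).

Lemma ddK i (a : V i) : dd V i.+1 (dd V i a) = 0.
Proof. by apply: realise_inj; apply: ext_derivativeK; apply: ddP. Qed.

(* A linear projection defined only on a subspace of forms (containing
   the discrete ones) can be extended to all forms with both properties, so a
   total domain is no restriction. *)
Definition boundary_preserving_projections
    (Pi : forall i, {linear dform R n -> V i}) :=
  (forall i (a : V i), Pi i (realise V a) = a) /\
  (forall i al, has_degree i al -> vanishes_at_boundary Om i al ->
     vanishes_at_boundary Om i (realise V (Pi i al))).

Record discrete_liealg := DiscreteLiealg {
  component :> forall i, 'End(V i);
  componentP :
    forall i, (dd V i \o component i = component i.+1 \o dd V i)%VF }.

Definition bracket_component (A B : discrete_liealg) i : 'End(V i) :=
  (A i \o B i - B i \o A i)%VF.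

Lemma bracketP A B i :
  (dd V i \o bracket_component A B i =
   bracket_component A B i.+1 \o dd V i)%VF.
Proof.
have comE (C : discrete_liealg) j (a : V j) :
    dd V j (C j a) = C j.+1 (dd V j a).
  by have /lfunP/(_ a) := componentP C j; rewrite !comp_lfunE.
apply/lfunP => a; rewrite !(comp_lfunE, add_lfunE, opp_lfunE) linearB/=.
by rewrite !comE.
Qed.

Definition bracket A B := DiscreteLiealg (bracketP A B).

Lemma iprod_is_linear (u : 'rV[R]_n -> 'rV[R]_n) : linear (@iprod R n u).
Proof.
move=> c al be; apply/funext => x; apply/ffunP => I; rewrite !ffunE.
rewrite scaler_sumr -big_split/=; apply: eq_bigr => j _.
by rewrite !ffunE /GRing.scale/=; ring.
Qed.

HB.instance Definition _ u := GRing.isLinear.Build R (dform R n) (dform R n)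
  _ (@iprod R n u) (iprod_is_linear u).

Variable Pi : forall i, {linear dform R n -> V i}.

Definition advect (u : X) i : V i -> V i :=
  match i return V i -> V i with
  | 0 => fun a => Pi 0 (iprod (field_of X u) (realise V (dd V 0 a)))
  | j.+1 => fun a => dd V j (Pi j (iprod (field_of X u) (realise V a))) +
                     Pi j.+1 (iprod (field_of X u) (realise V (dd V j.+1 a)))
  end.

Lemma advect_is_linear u i : linear (advect u (i := i)).
Proof.
case: i => [|i] c a b /=; rewrite !linearP//.
by rewrite scalerDr addrACA.
Qed.

HB.instance Definition _ u i := GRing.isLinear.Build R (V i) (V i)
  _ (advect u (i := i)) (advect_is_linear u (i := i)).

Lemma advectP u i :
  (dd V i \o linfun (advect u (i := i)) =
   linfun (advect u (i := i.+1)) \o dd V i)%VF.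
Proof.
apply/lfunP => a; rewrite !comp_lfunE !lfunE /= ddK !linear0 addr0.
by case: i a => [|i] a //=; rewrite linearD/= ddK add0r.
Qed.

Definition advection (u : X) : discrete_liealg := DiscreteLiealg (advectP u).

End Advection.

Section Scheme.
Context (R : realType) (n : nat) (Om : set 'rV[R]_n).
Context (V : discrete_forms Om) (X : discrete_fields Om).
Context (Pi : forall i, {linear dform R n -> V i}).
Context (hat : discrete_liealg V -> X).
Context (e Fr Fs : R -> R -> R).

(* (velocity, density, entropy, magnetic field) *)
Definition state : Type := (X * V n * V n * V n.-1)%type.

Definition midpoint (U : lmodType R) (a b : U) : U := 2^-1 *: (a + b).

(* (f b - f a) / (b - a), with value d where it reads 0 / 0 *)
Definition diff_quotient (f : R -> R) (d a b : R) : R :=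
  if a == b then d else (f b - f a) / (b - a).

(* [Fr r s] and [Fs r s] are the values given to the difference quotients of
   F in density and in entropy at points where both time levels agree
   (typically the partial derivatives of F). *)
Definition momentum_integrand (dt : R) (s0 s1 : state) (v : X)
    (x : 'rV[R]_n) : R :=
  let: (u0, r0, z0, b0) := s0 in
  let: (u1, r1, z1, b1) := s1 in
  let um := midpoint u0 u1 in
  let rm := midpoint r0 r1 in
  let zm := midpoint z0 z1 in
  let bm := midpoint b0 b1 in
  let vel (u : X) := field_of X u x in
  let den (a : V n) := density (realise V a) x in
  let A w := advection Pi w in
  let F r z := r * e r z in
  dotp (dt^-1 *: (den r1 *: vel u1 - den r0 *: vel u0)) (vel v)
  - dotp (den rm *: vel um) (vel (hat (bracket (A v) (A um))))
  + (dotp (vel u0) (vel u1) / 2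
     - 2^-1 * (diff_quotient (F ^~ (den z1)) (Fr (den r0) (den z1))
                 (den r0) (den r1)
             + diff_quotient (F ^~ (den z0)) (Fr (den r0) (den z0))
                 (den r0) (den r1))) * den (A v n rm)
  - 2^-1 * (diff_quotient (F (den r1)) (Fs (den r1) (den z0))
              (den z0) (den z1)
          + diff_quotient (F (den r0)) (Fs (den r0) (den z0))
              (den z0) (den z1)) * den (A v n zm)
  - density (wedge (realise V bm) (hodge (realise V (A v n.-1 bm)))) x.

(* s0 is at time level k and s1 at time level k+1.  Integrability is required
   because the library's integral is total. *)
Definition scheme (dt : R) (s0 s1 : state) : Prop :=
  let: (u0, r0, z0, b0) := s0 in
  let: (u1, r1, z1, b1) := s1 in
  let Am := advection Pi (midpoint u0 u1) in
  [/\ forall v : X,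
        integrable_on Om (momentum_integrand dt s0 s1 v) /\
        integral_on Om (momentum_integrand dt s0 s1 v) = 0,
      dt^-1 *: (r1 - r0) + Am n (midpoint r0 r1) = 0,
      dt^-1 *: (z1 - z0) + Am n (midpoint z0 z1) = 0 &
      dt^-1 *: (b1 - b0) + Am n.-1 (midpoint b0 b1) = 0].

(* The graph of S(dt): the scheme is implicit, so S(dt) is in general a
   partial, possibly multivalued map. *)
Definition solution_map (dt : R) : set (state * state) :=
  [set s | scheme dt s.1 s.2].

End Scheme.

(* Main.v *)
Require Import Defs.
From HB Require Import structures.
From mathcomp Require Import all_boot all_order all_algebra.
From mathcomp Require Import all_classical all_reals all_analysis.

Import Order.TTheory GRing.Theory Num.Theory.
Local Open Scope classical_set_scope.
Local Open Scope ring_scope.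

(** The scheme is symmetric: exchanging the two time levels and changing the
sign of the time step turns its equations into themselves.  Midpoints, the
product of the two velocities and the advection operator of the midpoint
velocity do not see the order of the levels.  The discrete time derivatives
change sign under the exchange, which the sign of the time step compensates.
A difference quotient is symmetric in its end points, so the exchange only
permutes the two summands of each averaged quotient of the internal energy
([diff_quotientC], [momentum_integrandC]).  Hence the graph of the solution map
for the time step [- dt] is the converse of the one for [dt] ([schemeN]), and
when both graphs are graphs of maps, these maps are inverse to each other. *)

Section Reversal.
Context (R : realType) (n : nat) (Om : set 'rV[R]_n).
Context (V : discrete_forms Om) (X : discrete_fields Om).
Context (Pi : forall i : nat, {linear dform R n -> V i}).
Context (hat : discrete_liealg V -> X).
Context (e Fr Fs : R -> R -> R).
Implicit Types (dt : R) (s : state V X).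

Lemma midpointC (U : lmodType R) (a b : U) : midpoint a b = midpoint b a.
Proof. by rewrite /midpoint addrC. Qed.

Lemma dotpC (u v : 'rV[R]_n) : dotp u v = dotp v u.
Proof. by apply: eq_bigr => i _; rewrite mulrC. Qed.

Lemma increment_quotientN (U : lmodType R) dt (a b : U) :
  (- dt)^-1 *: (b - a) = dt^-1 *: (a - b).
Proof. by rewrite invrN scaleNr -scalerN opprB. Qed.

(** The default value is a function of the left end point: it is only used
where the two end points agree, so it does not break the symmetry. *)
Lemma diff_quotientC (f d : R -> R) (a b : R) :
  diff_quotient f (d a) a b = diff_quotient f (d b) b a.
Proof.
rewrite /diff_quotient [b == a]eq_sym.
have [->//|_] := eqVneq a b.
by rewrite -[f b - f a]opprB -[b - a]opprB invrN mulrNN.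
Qed.

Lemma momentum_integrandC dt s0 s1 v :
  momentum_integrand Pi hat e Fr Fs (- dt) s0 s1 v =
  momentum_integrand Pi hat e Fr Fs dt s1 s0 v.
Proof.
case: s0 => [[[u0 r0] z0] b0]; case: s1 => [[[u1 r1] z1] b1].
apply/funext => x; rewrite /momentum_integrand increment_quotientN.
rewrite (midpointC _ u0) (midpointC _ r0) (midpointC _ z0) (midpointC _ b0).
rewrite (dotpC (field_of X u0 x)).
set p0 := density (realise V r0) x; set p1 := density (realise V r1) x.
set q0 := density (realise V z0) x; set q1 := density (realise V z1) x.
rewrite (diff_quotientC _ (Fr ^~ q1) p0) (diff_quotientC _ (Fr ^~ q0) p0).
rewrite (diff_quotientC _ (Fs p1) q0) (diff_quotientC _ (Fs p0) q0).
congr (_ + _ * _ - _ * _ - _); last by congr (_ * _); apply: addrC.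
by congr (_ - _ * _); apply: addrC.
Qed.

Lemma schemeN dt s0 s1 :
  scheme Pi hat e Fr Fs (- dt) s0 s1 <-> scheme Pi hat e Fr Fs dt s1 s0.
Proof.
have momentumN : (forall v,
    integrable_on Om (momentum_integrand Pi hat e Fr Fs (- dt) s0 s1 v) /\
    integral_on Om (momentum_integrand Pi hat e Fr Fs (- dt) s0 s1 v) = 0) <->
  (forall v,
    integrable_on Om (momentum_integrand Pi hat e Fr Fs dt s1 s0 v) /\
    integral_on Om (momentum_integrand Pi hat e Fr Fs dt s1 s0 v) = 0).
  by split=> H v; have := H v; rewrite momentum_integrandC.
case: s0 s1 momentumN => [[[u0 r0] z0] b0] [[[u1 r1] z1] b1] momentumN.
rewrite /scheme !increment_quotientN.
rewrite (midpointC _ u0) (midpointC _ r0) (midpointC _ z0) (midpointC _ b0).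
by split=> -[/momentumN].
Qed.

End Reversal.

Theorem proposition10 (R : realType) (n : nat) (n23 : n = 2%N \/ n = 3%N)
    (Om : set 'rV[R]_n) (domOm : is_domain Om)
    (V : discrete_forms Om) (X : discrete_fields Om)
    (Pi : forall i : nat, {linear dform R n -> V i})
    (projPi : boundary_preserving_projections Pi)
    (hat : discrete_liealg V -> X)
    (advection_inj : injective (advection (X := X) Pi))
    (hatK : cancel (advection (X := X) Pi) hat)
    (e Fr Fs : R -> R -> R) (dt : R) (dt0 : dt != 0) :
  solution_map Pi hat e Fr Fs (- dt) =
    ((solution_map Pi hat e Fr Fs dt)^-1)%relation
  /\
  forall S S' : state V X -> state V X,
    (forall s0 s1, solution_map Pi hat e Fr Fs dt (s0, s1) <-> s1 = S s0) ->
    (forall s0 s1, solution_map Pi hat e Fr Fs (- dt) (s0, s1) <-> s1 = S' s0) ->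
    cancel S S' /\ cancel S' S.
Proof.
have graphN s0 s1 : solution_map Pi hat e Fr Fs (- dt) (s0, s1) <->
    solution_map Pi hat e Fr Fs dt (s1, s0) by exact: schemeN.
split; first by apply/seteqP; split=> -[s0 s1] /graphN.
move=> S S' graphS graphS'; split=> s; apply/esym.
  by apply/graphS'/graphN/graphS.
by apply/graphS/graphN/graphS'.
Qed.
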